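(* Suppose $\beta\in\left(1-\max\{m_1,m_2\}^{-1},1\right)$. For $\varepsilon\in(0,1]$ let $\mu^*_\varepsilon$ be the unique invariant probability measure of the Recency Weighted Sampler with error parameter $\varepsilon$. Then for every $\delta>0$, $$\lim_{\varepsilon\to0}\mu^*_\varepsilon\left(B_\delta(\mathscr{C})\right)=1,$$ where $B_\delta(\mathscr{C})=\bigcup_{C}B_\delta(C)$, the union being over all minimal CURB blocks $C$ of the game.
   Context: Setting. $G$ is a finite two-player normal form game with roles $i\in\{1,2\}$ ($-i$ denotes the other role), pure strategy sets $S_1,S_2$ with $|S_i|=m_i$. $\Delta(S_i)$ is the set of mixed strategies, identified with the simplex of probability vectors in $\mathbb{R}^{m_i}$; $\square(S)=\Delta(S_1)\times\Delta(S_2)$. For $s\in S_i$, $\overrightarrow{1_{i,s}}\in\Delta(S_i)$ is the unit vector of the pure strategy $s$. For $\sigma\in\Delta(S_{-i})$, $BR_i(\sigma)\subset S_i$ is the set of pure best replies of player $i$ to $\sigma$; for $\sigma=(\sigma_1,\sigma_2)\in\square(S)$, $BR(\sigma)=BR_1(\sigma_2)\times BR_2(\sigma_1)$. Parameters: sample size $k\in\mathbb{N}$, $k\ge1$; recency parameter $\beta\in(0,1)$; error parameter $\varepsilon\in[0,1]$. Stochastic best reply. For $p\in\Delta(S_{-i})$, the random variable $\widetilde{BR}_i(p)\in S_i$ is generated as follows: draw $(n_s)_{s\in S_{-i}}$ from the multinomial distribution with parameters $k$ and $p$ and put $D=\frac1k\sum_{s\in S_{-i}}n_s\overrightarrow{1_{-i,s}}$;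 with probability $1-\varepsilon$ choose an element of $BR_i(D)$ uniformly at random; with probability $\varepsilon$ choose an element of $S_i$ uniformly at random. Recency Weighted Sampler (RWS). It is the Markov chain $p(t)=(p_1(t),p_2(t))$ on $\square(S)$ with $p_i(t+1)=\beta p_i(t)+(1-\beta)\overrightarrow{1_{i,s_i(t)}}$, $s_i(t)=\widetilde{BR}_i(p_{-i}(t))$, where, given $p(t)$, the two players' draws are independent of each other. For $\varepsilon>0$ and $\beta\in(1-\max\{m_1,m_2\}^{-1},1)$ it has a unique invariant probability measure $\mu^*_\varepsilon$. CURB blocks. A block is a set $C=C_1\times C_2$ with nonempty $C_i\subset S_i$, and $\square(C)=\Delta(C_1)\times\Delta(C_2)\subset\square(S)$. Convention: ''CURB'' here means $k$-CURB, i.e. $BR(\sigma)\subset C$ for every $\sigma\in\square(C)$ all of whose coordinates are integer multiples of $1/k$ (for $k$ sufficiently large this coincides with the usual notion, where all $\sigma\in\square(C)$ are considered). A minimal CURB block is a CURB block that contains no strictly smaller CURB block. Neighbourhoods. For a block $C=C_1\times C_2$ and $\delta>0$, $B_\delta(C)=\{(p_1,p_2)\in\square(S):\ \sum_{s\in C_i}p_{i,s}\ge1-\delta,\ i=1,2\}$. *)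

(* Defs.v *)
From HB Require Import structures.
From mathcomp Require Import all_boot all_order all_algebra.
From mathcomp Require Import all_classical all_reals all_analysis.
Set Implicit Arguments.
Unset Strict Implicit.
Unset Printing Implicit Defensive.
Import Order.TTheory GRing.Theory Num.Theory.
Import numFieldNormedType.Exports.
Local Open Scope classical_set_scope.
Local Open Scope ring_scope.

(* Nonempty finite types.  The distinguished point only records nonemptiness
   (measurable types are pointed); nothing below depends on its value. *)
#[short(type="pfinType")]
HB.structure Definition PointedFinite := {T of Finite T & Pointed T}.
HB.instance Definition _ n := isPointed.Build 'I_n.+1 ord0.

Section mixed_strategies.
Variables (R : realType) (S : finType).

Definition is_mixed (p : {ffun S -> R}) : bool :=
  [forall s, 0 <= p s] && (\sum_s p s == 1).

Record mixed := Mixed {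
  prob_of :> {ffun S -> R} ;
  prob_ofP : is_mixed prob_of }.

HB.instance Definition _ := [isSub for prob_of].
HB.instance Definition _ := [Choice of mixed by <:].

Lemma mixed_ge0 (p : mixed) s : 0 <= p s.
Proof. by case/andP: (prob_ofP p) => /forallP. Qed.

Lemma mixed_sum1 (p : mixed) : \sum_s p s = 1.
Proof. by case/andP: (prob_ofP p) => _ /eqP. Qed.

Lemma pure_subproof s0 : is_mixed [ffun s => (s == s0)%:R].
Proof.
apply/andP; split; first by apply/forallP => s; rewrite ffunE.
by rewrite (bigD1 s0)//= ffunE eqxx big1 ?addr0// => s /negPf s0s; rewrite ffunE s0s.
Qed.

Definition pure s0 : mixed := Mixed (pure_subproof s0).

Lemma recency_subproof (beta : {i01 R}) (p : mixed) s0 :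
  is_mixed [ffun s => beta%:num * p s + (1 - beta%:num) * pure s0 s].
Proof.
apply/andP; split.
  apply/forallP => s; rewrite ffunE.
  by rewrite addr_ge0 ?mulr_ge0 ?mixed_ge0 ?subr_ge0.
under eq_bigr do rewrite ffunE.
rewrite big_split -!mulr_sumr mixed_sum1 (mixed_sum1 (pure s0)) !mulr1/=.
by apply/eqP; exact: subrKC.
Qed.

Definition recency_update (beta : {i01 R}) (p : mixed) s0 : mixed :=
  Mixed (recency_subproof beta p s0).

(* Cylinders; since S is finite they generate the Borel sigma-algebra of the
   simplex. *)
Definition mixed_cylinders : set (set mixed) :=
  [set A | exists s (B : set R),
     measurable B /\ A = (fun p : mixed => p s) @^-1` B].

End mixed_strategies.

HB.instance Definition _ (R : realType) (S : pfinType) :=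
  isPointed.Build (mixed R S) (pure R (point : S)).
HB.instance Definition _ (R : realType) (S : pfinType) :=
  Measurable.copy (mixed R S) (g_sigma_algebraType (@mixed_cylinders R S)).

(* Maximizers of the expected payoff; q is only ever a probability vector. *)
Definition best_replies (R : realType) (S T : finType) (u : S -> T -> R)
    (q : T -> R) : {set S} :=
  [set s | [forall s', \sum_t q t * u s' t <= \sum_t q t * u s t]].

Section stochastic_best_reply.
Variables (R : realType) (k : nat) (eps : R) (S T : finType).

(* Counts are bounded by the number k of draws, hence live in 'I_k.+1. *)
Definition multinomial_pmf (p : mixed R T) (n : {ffun T -> 'I_k.+1}) : R :=
  if (\sum_t n t == k)%N then
    k`!%:R / (\prod_t (n t)`!)%N%:R * \prod_t p t ^+ n t
  else 0.

Definition empirical (n : {ffun T -> 'I_k.+1}) (t : T) : R :=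
  (n t)%:R / k%:R.

Definition uniform_pmf (A : {set S}) (s : S) : R := (s \in A)%:R / #|A|%:R.

Definition stochastic_best_reply (u : S -> T -> R) (p : mixed R T) (s : S) : R :=
  \sum_(n : {ffun T -> 'I_k.+1}) multinomial_pmf p n *
    ((1 - eps) * uniform_pmf (best_replies u (empirical n)) s +
     eps * uniform_pmf [set: S]%SET s).

End stochastic_best_reply.

Record game (R : realType) (S1 S2 : finType) := Game {
  payoff1 : S1 -> S2 -> R ;
  payoff2 : S2 -> S1 -> R (* own strategy first *) }.

Notation profile R S1 S2 := (mixed R S1 * mixed R S2)%type.

Section recency_weighted_sampler.
Variables (R : realType) (S1 S2 : pfinType) (G : game R S1 S2).
Variables (k : nat) (beta : {i01 R}) (eps : R).

Definition RWS_update (p : profile R S1 S2) (s : S1 * S2) : profile R S1 S2 :=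
  (recency_update beta p.1 s.1, recency_update beta p.2 s.2).

(* One-step transition probability from p into A: given p, the two players'
   stochastic best replies are independent. *)
Definition RWS_kernel (p : profile R S1 S2) (A : set (profile R S1 S2)) :
    \bar R :=
  (\sum_(s : S1 * S2)
     (stochastic_best_reply k eps (payoff1 G) p.2 s.1 *
      stochastic_best_reply k eps (payoff2 G) p.1 s.2)%:E *
     \d_(RWS_update p s) A)%E.

Definition RWS_invariant (mu : probability (profile R S1 S2) R) : Prop :=
  forall A, measurable A -> (\int[mu]_p RWS_kernel p A)%E = mu A.

End recency_weighted_sampler.

Section curb.
Variables (R : realType) (S1 S2 : finType) (G : game R S1 S2) (k : nat).
Implicit Types C D : {set S1} * {set S2}.

Definition is_block C : Prop := C.1 != finset.set0 /\ C.2 != finset.set0.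

Definition sub_block D C : Prop := D.1 \subset C.1 /\ D.2 \subset C.2.

(* Product of the faces of the two simplices spanned by C.1 and C.2. *)
Definition square C : set (profile R S1 S2) :=
  [set p : profile R S1 S2 |
    (forall s, s \notin C.1 -> p.1 s = 0) /\
    (forall s, s \notin C.2 -> p.2 s = 0)].

Definition on_grid (p : profile R S1 S2) : Prop :=
  (forall s, exists z : int, p.1 s = z%:~R / k%:R) /\
  (forall s, exists z : int, p.2 s = z%:~R / k%:R).

Definition BR (p : profile R S1 S2) : {set S1} * {set S2} :=
  (best_replies (payoff1 G) p.2, best_replies (payoff2 G) p.1).

(* The k-sample version of CURB: only profiles in (1/k)Z are tested. *)
Definition curb C : Prop :=
  is_block C /\
  forall p, square C p -> on_grid p -> sub_block (BR p) C.

Definition minimal_curb C : Prop :=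
  curb C /\ forall D, curb D -> sub_block D C -> D = C.

Definition block_nbhd (delta : R) C : set (profile R S1 S2) :=
  [set p : profile R S1 S2 |
    1 - delta <= \sum_(s in C.1) p.1 s /\ 1 - delta <= \sum_(s in C.2) p.2 s].

End curb.

(* Main.v *)
(* Measure the distance to the minimal CURB blocks by the Lyapunov function
   V = min(1, M * outside C), minimized over the minimal CURB blocks C, where
   outside C is the total weight that the two players put off C.
   Without errors, V is a supermartingale that contracts where V < 1: a sample
   leaves C with probability at most k * outside C, and otherwise the outside
   weight shrinks by the factor beta.  Moreover, after some fixed number of
   steps V drops below 1 with probability bounded below uniformly in the
   starting profile: some pair of strategies has weight bounded below; sampling
   only strategies known to have such weight, one first enlarges this set by its
   best replies until it is a CURB block, and then stays in a minimal one.
   Hence n error-free steps multiply the mean of V by a factor gamma < 1, and an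
   error probability eps adds O(eps); invariance then gives
   (1 - gamma) * \int V d mu_eps = O(eps), and Markov's inequality concludes. *)

Require Import Defs.
From HB Require Import structures.
From mathcomp Require Import all_boot all_order all_algebra.
From mathcomp Require Import all_classical all_reals all_analysis.
From mathcomp Require Import measurable_realfun ring lra.
Set Implicit Arguments.
Unset Strict Implicit.
Unset Printing Implicit Defensive.
Import Order.TTheory GRing.Theory Num.Theory.
Import numFieldNormedType.Exports.
Local Open Scope classical_set_scope.
Local Open Scope ring_scope.

(** * Multinomial sampling *)

(** Truncation at degree [k] is invisible up to that degree, so the coefficients are those of the
    exponential series of the total [\sum_(t <- r) q t]. The induction step is the binomial
    theorem. *)
Lemma coef_prod_truncated_exp (R : numFieldType) (T : Type) (k : nat)
    (q : T -> R) (r : seq T) (j : nat) : (j <= k)%N ->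
  (\prod_(t <- r) \poly_(i < k.+1) (q t ^+ i / i`!%:R))`_j =
  (\sum_(t <- r) q t) ^+ j / j`!%:R.
Proof.
have fact0 n : n`!%:R != 0 :> R by rewrite pnatr_eq0 -lt0n fact_gt0.
elim: r j => [|t r IH] j jk.
  rewrite !big_nil coef1; case: j jk => [|j] _; first by rewrite expr0 divr1.
  by rewrite expr0n mul0r.
rewrite !big_cons coefM [q t + _]addrC exprDn mulr_suml.
apply: eq_bigr => -[i /= ij] _; rewrite ltnS in ij.
rewrite coef_poly ltnS (leq_trans ij jk) IH ?(leq_trans (leq_subr _ _))//.
rewrite -(bin_fact ij) -[X in _ = X / _]mulr_natr !natrM.
have bin0 : 'C(j, i)%:R != 0 :> R by rewrite pnatr_eq0 -lt0n bin_gt0.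
by field; rewrite bin0 !fact0.
Qed.

(** Distributing a product of truncated exponential series over its sums and reading off degree [k]
    gives the left-hand side; the exponents up to [k] are exactly the counts in ['I_k.+1]. *)
Lemma multinomial_theorem (R : numFieldType) (T : finType) (k : nat)
    (q : T -> R) :
  \sum_(n : {ffun T -> 'I_k.+1} | (\sum_t n t == k)%N)
    k`!%:R / (\prod_t (n t)`!)%N%:R * \prod_t q t ^+ n t = (\sum_t q t) ^+ k.
Proof.
have fact0 n : n`!%:R != 0 :> R by rewrite pnatr_eq0 -lt0n fact_gt0.
have -> : (\sum_t q t) ^+ k =
    (\prod_t \poly_(i < k.+1) (q t ^+ i / i`!%:R))`_k * k`!%:R.
  by rewrite (@coef_prod_truncated_exp _ _ k)// divfK.
under [in RHS]eq_bigr do rewrite poly_def.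
rewrite bigA_distr_bigA /= coef_sum mulr_suml big_mkcond/=.
apply: eq_bigr => n _.
under [in RHS]eq_bigr do rewrite -mul_polyC.
rewrite big_split/= -rmorph_prod/= mul_polyC coefZ.
have -> : \prod_t 'X^(n t) = 'X^(\sum_t n t) :> {poly R}.
  by rewrite -prodrXr.
rewrite coefXn eq_sym; case: ifP => _; last by rewrite mulr0 mul0r.
by rewrite mulr1 big_split/= prodfV natr_prod; ring.
Qed.

(** A form of Bernoulli's inequality, used as the union bound for the event that one of [k]
    independent draws misses a set of probability [x]. *)
Lemma one_sub_exprn_le (R : realDomainType) (x : R) (k : nat) :
  0 <= x <= 1 -> 1 - x ^+ k <= k%:R * (1 - x).
Proof.
move=> /andP[x0 x1]; elim: k => [|k IH]; first by rewrite expr0 subrr mul0r.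
rewrite exprS -natr1 mulrDl mul1r.
have -> : 1 - x * x ^+ k = x * (1 - x ^+ k) + (1 - x) by ring.
rewrite lerD2r (le_trans _ IH)// ler_piMl// subr_ge0 exprn_ile1//.
Qed.

Lemma big_setIDC (R : nmodType) (T : finType) (D : {set T}) (F : T -> R) :
  \sum_t F t = \sum_(t in D) F t + \sum_(t in ~: D) F t.
Proof.
rewrite (bigID (fun t => t \in D))/=; congr (_ + _).
by apply: eq_bigl => t; rewrite inE.
Qed.

(** * Sample probabilities and bounds on stochastic best replies *)

Section stochastic_best_reply.
Variables (R : realType) (k : nat).

Lemma multinomial_pmf_ge0 (T : finType) (p : mixed R T)
    (n : {ffun T -> 'I_k.+1}) : 0 <= multinomial_pmf p n.
Proof.
rewrite /multinomial_pmf; case: ifP => // _; rewrite mulr_ge0 ?divr_ge0 ?ler0n//.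
by apply: prodr_ge0 => t _; rewrite exprn_ge0// mixed_ge0.
Qed.

Definition sample_in (T : finType) (D : {set T}) (n : {ffun T -> 'I_k.+1}) :=
  [forall t, (t \notin D) ==> (n t == 0%N :> nat)].

(** This is the multinomial theorem for [p] set to zero off [D]: a positive count off [D] kills the
    term, while a zero count contributes the factor [0 ^+ 0 = 1]. *)
Lemma sum_multinomial_pmf_in (T : finType) (p : mixed R T) (D : {set T}) :
  \sum_(n : {ffun T -> 'I_k.+1} | sample_in D n) multinomial_pmf p n =
  (\sum_(t in D) p t) ^+ k.
Proof.
rewrite [X in X ^+ _]big_mkcond -multinomial_theorem.
rewrite big_mkcond [RHS]big_mkcond/=; apply: eq_bigr => n _.
rewrite /multinomial_pmf; case: ifPn => [/forallP nD|]; case: ifP => // _.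
  congr (_ * _); apply: eq_bigr => t _; case: ifPn => // /(implyP (nD t)) /eqP.
  by move=> ->; rewrite !expr0.
move=> /forallPn[t]; rewrite negb_imply => /andP[/negPf tD nt0].
by rewrite [X in _ * X](bigD1 t)//= tD expr0n (negPf nt0) mul0r mulr0.
Qed.

Lemma sum_multinomial_pmf (T : finType) (p : mixed R T) :
  \sum_(n : {ffun T -> 'I_k.+1}) multinomial_pmf p n = 1.
Proof.
transitivity (\sum_(n : {ffun T -> 'I_k.+1} | sample_in [set: T]%SET n)
  multinomial_pmf p n).
  by apply: eq_bigl => n; apply/esym/forallP => t; rewrite inE.
rewrite sum_multinomial_pmf_in.
by under eq_bigl do rewrite inE; rewrite mixed_sum1 expr1n.
Qed.

Lemma uniform_pmf_ge0 (S : finType) (A : {set S}) s : 0 <= uniform_pmf R A s.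
Proof. by rewrite divr_ge0 ?ler0n. Qed.

Lemma uniform_pmf_le1 (S : finType) (A : {set S}) s : uniform_pmf R A s <= 1.
Proof.
rewrite /uniform_pmf; have [sA|_] := boolP (s \in A); last by rewrite mul0r.
rewrite mul1r invf_le1 ?ltr0n ?ler1n; first by apply/card_gt0P; exists s.
by apply/card_gt0P; exists s.
Qed.

Lemma uniform_pmf_sum1 (S : finType) (A : {set S}) :
  A != finset.set0 -> \sum_s uniform_pmf R A s = 1.
Proof.
move=> A0; rewrite -mulr_suml -natr_sum -big_mkcond/= sum1_card divff//.
by rewrite pnatr_eq0 cards_eq0.
Qed.

Lemma best_replies_neq0 (S T : finType) (u : S -> T -> R) q (s0 : S) :
  best_replies u q != finset.set0.
Proof.
apply/set0Pn.
have [s _ smax] := @Order.TotalTheory.arg_maxP _ R S s0 xpredT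
  (fun s => \sum_t q t * u s t) isT.
by exists s; rewrite inE; apply/forallP => s'; exact: smax.
Qed.

Variables (S T : finType) (u : S -> T -> R).
Implicit Types (p : mixed R T) (n : {ffun T -> 'I_k.+1}).

Local Notation sbr eps := (stochastic_best_reply k eps u).

Lemma stochastic_best_reply0E p s :
  sbr 0 p s = \sum_(n : {ffun T -> 'I_k.+1})
    multinomial_pmf p n * uniform_pmf R (best_replies u (empirical R n)) s.
Proof. by apply: eq_bigr => n _; rewrite subr0 mul1r mul0r addr0. Qed.

(** Errors ignore the sample, so the multinomial weights sum to 1 in the error term. *)
Lemma stochastic_best_replyE eps p s :
  sbr eps p s = (1 - eps) * sbr 0 p s + eps * uniform_pmf R [set: S]%SET s.
Proof.
rewrite stochastic_best_reply0E.
have -> : eps * uniform_pmf R [set: S]%SET s =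
    \sum_(n : {ffun T -> 'I_k.+1}) multinomial_pmf p n *
    (eps * uniform_pmf R [set: S]%SET s).
  by rewrite -mulr_suml sum_multinomial_pmf mul1r.
rewrite mulr_sumr -big_split.
by apply: eq_bigr => n _ /=; ring.
Qed.

Lemma stochastic_best_reply0_ge0 p s : 0 <= sbr 0 p s.
Proof.
rewrite stochastic_best_reply0E sumr_ge0// => n _.
by rewrite mulr_ge0 ?multinomial_pmf_ge0 ?uniform_pmf_ge0.
Qed.

Lemma stochastic_best_reply_ge0 eps p s : 0 <= eps <= 1 -> 0 <= sbr eps p s.
Proof.
move=> /andP[e0 e1]; rewrite stochastic_best_replyE addr_ge0// mulr_ge0//.
- by rewrite subr_ge0.
- exact: stochastic_best_reply0_ge0.
- exact: uniform_pmf_ge0.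
Qed.

Lemma stochastic_best_reply_le eps p s : 0 <= eps <= 1 ->
  sbr eps p s <= sbr 0 p s + eps.
Proof.
move=> /andP[e0 e1]; rewrite stochastic_best_replyE lerD//.
  by rewrite ler_piMl ?stochastic_best_reply0_ge0// gerBl.
by rewrite ler_piMr ?uniform_pmf_le1.
Qed.

Lemma stochastic_best_reply0_sum1 p (s0 : S) : \sum_s sbr 0 p s = 1.
Proof.
under eq_bigr do rewrite stochastic_best_reply0E.
rewrite exchange_big/= -(sum_multinomial_pmf p); apply: eq_bigr => n _.
by rewrite -mulr_sumr uniform_pmf_sum1 ?mulr1// best_replies_neq0.
Qed.

Lemma stochastic_best_reply_sum1 eps p (s0 : S) : \sum_s sbr eps p s = 1.
Proof.
under eq_bigr do rewrite stochastic_best_replyE.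
rewrite big_split/= -!mulr_sumr stochastic_best_reply0_sum1//.
rewrite uniform_pmf_sum1 ?mulr1 ?subrK//.
by apply/set0Pn; exists s0; rewrite inE.
Qed.

(** An error-free reply can leave [E] only if one of the [k] draws falls outside [D]; the estimate
    is the union bound over the draws. *)
Lemma stochastic_best_reply0_outside (D : {set T}) (E : {set S}) p (s0 : S) :
  (forall n, (\sum_t n t = k)%N -> sample_in D n ->
    best_replies u (empirical R n) \subset E) ->
  \sum_(s in ~: E) sbr 0 p s <= k%:R * \sum_(t in ~: D) p t.
Proof.
move=> DE.
have -> : \sum_(t in ~: D) p t = 1 - \sum_(t in D) p t.
  by rewrite -(mixed_sum1 p) (big_setIDC D) addrAC subrr add0r.
have pD : 0 <= \sum_(t in D) p t <= 1.
  rewrite sumr_ge0 => [|t _]; last exact: mixed_ge0.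
  by rewrite -(mixed_sum1 p) (big_setIDC D) lerDl sumr_ge0// => t _;
    rewrite mixed_ge0.
apply: le_trans (one_sub_exprn_le k pD).
rewrite -sum_multinomial_pmf_in -(sum_multinomial_pmf p).
rewrite [in leRHS](bigID (sample_in D))/= addrAC subrr add0r.
under eq_bigr do rewrite stochastic_best_reply0E.
rewrite exchange_big/= [leRHS]big_mkcond/=; apply: ler_sum => n _.
rewrite -mulr_sumr; case: ifPn => [_|/negPn nD].
  rewrite ler_piMr ?multinomial_pmf_ge0//.
  rewrite -(uniform_pmf_sum1 (best_replies_neq0 u (empirical R n) s0)).
  rewrite (big_setIDC E) lerDr sumr_ge0// => s _.
  exact: uniform_pmf_ge0.
have [nk|nk] := eqVneq (\sum_t n t)%N k; last first.
  by rewrite /multinomial_pmf (negPf nk) mul0r.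
rewrite big1 ?mulr0// => s; rewrite inE => sE; rewrite /uniform_pmf.
by rewrite (negPf (contraNN (fintype.subsetP (DE n nk nD) s) sE)) mul0r.
Qed.

(** One favourable sample suffices. Its probability involves only the weights of the strategies it
    contains, hence a bound that is uniform in [p]. *)
Lemma stochastic_best_reply0_lower n (s : S) (c : R) :
  (\sum_t n t = k)%N -> s \in best_replies u (empirical R n) -> 0 < c ->
  exists2 eta, 0 < eta & forall p,
    (forall t, n t != 0%N :> nat -> c <= p t) -> eta <= sbr 0 p s.
Proof.
move=> nk sBR c0.
(* The contribution of the sample [n], with every weight [p t] replaced by [c]. *)
exists (k`!%:R / (\prod_t (n t)`!)%N%:R * \prod_t c ^+ n t *
    uniform_pmf R (best_replies u (empirical R n)) s).
  apply: mulr_gt0; last first.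
    by rewrite divr_gt0 ?ltr0n ?sBR//; apply/card_gt0P; exists s.
  apply: mulr_gt0; last by apply: prodr_gt0 => t _; rewrite exprn_gt0.
  by rewrite divr_gt0 ?ltr0n ?fact_gt0// prodn_gt0// => t; rewrite fact_gt0.
move=> p cp; rewrite stochastic_best_reply0E (bigD1 n)//=.
apply: ler_wpDr.
  apply: sumr_ge0 => n' _.
  by rewrite mulr_ge0 ?multinomial_pmf_ge0 ?uniform_pmf_ge0.
rewrite ler_wpM2r ?uniform_pmf_ge0// /multinomial_pmf nk eqxx.
rewrite ler_wpM2l ?divr_ge0 ?ler0n//; apply: ler_prod => t _.
rewrite exprn_ge0 ?(ltW c0)//=; have [->|nt0] := eqVneq (n t : nat) 0%N.
  by rewrite !expr0.
by rewrite lerXn2r ?nnegrE ?(ltW c0) ?mixed_ge0// cp.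
Qed.

End stochastic_best_reply.

(** * The transition operator *)

Lemma sum_prodM (R : comNzRingType) (S1 S2 : finType) (a : S1 -> R) (b : S2 -> R) :
  \sum_(s : S1 * S2) a s.1 * b s.2 = (\sum_s a s) * (\sum_s b s).
Proof. by rewrite big_distrlr pair_big. Qed.

Lemma empirical_is_mixed (R : realType) (T : finType) (k : nat)
    (n : {ffun T -> 'I_k.+1}) : (0 < k)%N -> (\sum_t n t = k)%N ->
  exists q : mixed R T, q =1 empirical R n.
Proof.
move=> k0 nk.
suff qP : is_mixed [ffun t => empirical R n t].
  by exists (Mixed qP) => t /=; rewrite ffunE.
apply/andP; split; first by apply/forallP => t; rewrite ffunE divr_ge0.
under eq_bigr do rewrite ffunE.
by rewrite -mulr_suml -natr_sum nk divff// pnatr_eq0 -lt0n.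
Qed.

(** Translates the grid profiles in the definition of CURB into samples: the numerators are counts
    because the weights lie between 0 and 1. *)
Lemma grid_is_empirical (R : realType) (T : finType) (k : nat) (q : mixed R T) :
  (0 < k)%N -> (forall t, exists z : int, q t = z%:~R / k%:R) ->
  exists2 n : {ffun T -> 'I_k.+1}, (\sum_t n t = k)%N & q =1 empirical R n.
Proof.
move=> k0 qz; have k0R : 0 < k%:R :> R by rewrite ltr0n.
have /choice[z zP] t : exists m : 'I_k.+1, q t = m%:R / k%:R.
  have [z qt] := qz t.
  have z0 : (0 <= z)%R.
    by rewrite -(ler0z R) -(pmulr_lge0 _ (_ : 0 < k%:R^-1)) ?invr_gt0// -qt mixed_ge0.
  have zk : (`|z| < k.+1)%N.
    rewrite ltnS -(ler_nat R) natr_absz ger0_norm//.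
    rewrite -[leRHS]mul1r -ler_pdivrMr// -qt -(mixed_sum1 q) (bigD1 t)//= lerDl.
    by rewrite sumr_ge0// => ? _; rewrite mixed_ge0.
  by exists (Ordinal zk); rewrite qt/= natr_absz ger0_norm.
exists [ffun t => z t]; last by move=> t; rewrite [LHS]zP /empirical ffunE.
apply/eqP; rewrite -(eqr_nat R) natr_sum.
have := mixed_sum1 q; rewrite (eq_bigr _ (fun t _ => zP t)).
rewrite -mulr_suml => /(canRL (mulfVK (lt0r_neq0 k0R))); rewrite mul1r => <-.
by apply/eqP; apply: eq_bigr => t _; rewrite ffunE.
Qed.

Lemma eq_best_replies (R : realType) (S T : finType) (u : S -> T -> R) q q' :
  q =1 q' -> best_replies u q = best_replies u q'.
Proof. by move=> /funext ->. Qed.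

Lemma pure_on_grid (R : realType) (S : finType) (k : nat) (s0 s : S) :
  (0 < k)%N -> exists z : int, pure R s0 s = z%:~R / k%:R.
Proof.
move=> k0; exists (if s == s0 then Posz k else 0).
rewrite ffunE; case: eqP => _ /=; last by rewrite mul0r.
by rewrite divff// pnatr_eq0 -lt0n.
Qed.

Section rws.
Variables (R : realType) (S1 S2 : pfinType) (G : game R S1 S2).
Variables (k : nat) (beta : {i01 R}).
Implicit Types (p q : profile R S1 S2) (s : S1 * S2) (f g : profile R S1 S2 -> R).
Implicit Types (C D : {set S1} * {set S2}) (eps : R).

Definition RWS_prob eps p s : R :=
  stochastic_best_reply k eps (payoff1 G) p.2 s.1 *
  stochastic_best_reply k eps (payoff2 G) p.1 s.2.

(** The Markov operator of the chain acting on functions: the mean of [f] after one step from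
    [p]. *)
Definition RWS_op eps f p : R :=
  \sum_s RWS_prob eps p s * f (RWS_update beta p s).

Lemma RWS_prob_ge0 eps p s : 0 <= eps <= 1 -> 0 <= RWS_prob eps p s.
Proof. by move=> e; rewrite mulr_ge0// stochastic_best_reply_ge0. Qed.

Lemma RWS_prob0_ge0 p s : 0 <= RWS_prob 0 p s.
Proof. by apply: RWS_prob_ge0; rewrite lexx ler01. Qed.

Lemma RWS_prob_sum1 eps p : \sum_s RWS_prob eps p s = 1.
Proof. by rewrite sum_prodM !stochastic_best_reply_sum1 ?mulr1//; exact: point. Qed.

Lemma stochastic_best_reply0_le1 (S : pfinType) (T : finType) (u : S -> T -> R)
    (p : mixed R T) (s : S) : stochastic_best_reply k 0 u p s <= 1.
Proof.
rewrite -(stochastic_best_reply0_sum1 k u p point) (bigD1 s)//= lerDl.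
by rewrite sumr_ge0// => *; exact: stochastic_best_reply0_ge0.
Qed.

(** For [a], [b] and [eps] at most 1, [(a + eps) * (b + eps)] exceeds [a * b] by
    [eps * (a + b + eps)], whence the factor 3. *)
Lemma RWS_prob_le eps p s : 0 <= eps <= 1 ->
  RWS_prob eps p s <= RWS_prob 0 p s + 3 * eps.
Proof.
move=> e; have /andP[e0 e1] := e.
have a1 := stochastic_best_reply0_le1 (payoff1 G) p.2 s.1.
have b1 := stochastic_best_reply0_le1 (payoff2 G) p.1 s.2.
have a0 := stochastic_best_reply0_ge0 k (payoff1 G) p.2 s.1.
have b0 := stochastic_best_reply0_ge0 k (payoff2 G) p.1 s.2.
have a := stochastic_best_reply_le k (payoff1 G) p.2 s.1 e.
have b := stochastic_best_reply_le k (payoff2 G) p.1 s.2 e.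
apply: (le_trans (ler_pM _ _ a b)); rewrite ?stochastic_best_reply_ge0//.
rewrite /RWS_prob; nra.
Qed.

Lemma RWS_op_homo eps f g : 0 <= eps <= 1 -> (forall p, f p <= g p) ->
  forall p, RWS_op eps f p <= RWS_op eps g p.
Proof.
by move=> e fg p; apply: ler_sum => s _; rewrite ler_wpM2l ?RWS_prob_ge0.
Qed.

Lemma RWS_op0_homo f g : (forall p, f p <= g p) ->
  forall p, RWS_op 0 f p <= RWS_op 0 g p.
Proof. by apply: RWS_op_homo; rewrite lexx ler01. Qed.

Lemma RWS_op_cst eps (c : R) p : RWS_op eps (fun=> c) p = c.
Proof. by rewrite /RWS_op -mulr_suml RWS_prob_sum1 mul1r. Qed.

Lemma RWS_op_le eps f p : 0 <= eps <= 1 -> (forall p, 0 <= f p <= 1) ->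
  RWS_op eps f p <= RWS_op 0 f p + 3 * eps * (#|S1| * #|S2|)%:R.
Proof.
move=> e f01; have /andP[e0 _] := e.
have -> : 3 * eps * (#|S1| * #|S2|)%:R = \sum_(s : S1 * S2) 3 * eps.
  by rewrite sumr_const card_prod mulr_natr.
rewrite -big_split/=; apply: ler_sum => s _.
have /andP[f0 f1] := f01 (RWS_update beta p s).
apply: (le_trans (ler_wpM2r f0 (RWS_prob_le p s e))).
by rewrite mulrDl lerD2l ler_piMr// mulr_ge0.
Qed.

(** All other moves contribute at most their probability, so the whole gain comes from the single
    move [s]. *)
Lemma RWS_op0_escape f p s (eta eta' : R) : (forall p, f p <= 1) ->
  0 <= eta' ->
  eta <= RWS_prob 0 p s -> f (RWS_update beta p s) <= 1 - eta' ->
  RWS_op 0 f p <= 1 - eta * eta'.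
Proof.
move=> f1 eta'0 ps fs; rewrite /RWS_op (bigD1 s)//=.
have -> : 1 - eta * eta' = RWS_prob 0 p s - eta * eta' +
    \sum_(t | t != s) RWS_prob 0 p t.
  by rewrite addrAC -(RWS_prob_sum1 0 p) (bigD1 s).
apply: lerD.
  apply: (le_trans (ler_wpM2l (RWS_prob0_ge0 p s) fs)).
  by rewrite mulrBr mulr1 lerD2l lerN2 ler_wpM2r.
by apply: ler_sum => t _; rewrite ler_piMr ?RWS_prob0_ge0.
Qed.

Hypothesis k_gt0 : (0 < k)%N.

(** The grid profile [q] serves as the pair of samples drawn; only the weights on its support
    matter. *)
Lemma RWS_prob0_lower q s (c : R) : on_grid k q ->
  s.1 \in (BR G q).1 -> s.2 \in (BR G q).2 -> 0 < c ->
  exists2 eta, 0 < eta & forall p,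
    (forall t, q.1 t != 0 -> c <= p.1 t) ->
    (forall t, q.2 t != 0 -> c <= p.2 t) -> eta <= RWS_prob 0 p s.
Proof.
move=> [q1 q2] s1 s2 c0.
have [n1 n1k n1q] := grid_is_empirical k_gt0 q1.
have [n2 n2k n2q] := grid_is_empirical k_gt0 q2.
rewrite /= (eq_best_replies _ n2q) in s1.
rewrite /= (eq_best_replies _ n1q) in s2.
have [e1 e10 e1P] := stochastic_best_reply0_lower n2k s1 c0.
have [e2 e20 e2P] := stochastic_best_reply0_lower n1k s2 c0.
exists (e1 * e2); first exact: mulr_gt0.
have k0R : k%:R != 0 :> R by rewrite pnatr_eq0 -lt0n.
move=> p p1 p2; apply: ler_pM (ltW e10) (ltW e20) (e1P _ _) (e2P _ _) => t nt.
  by apply: p2; rewrite n2q /empirical mulf_neq0 ?invr_neq0// pnatr_eq0.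
by apply: p1; rewrite n1q /empirical mulf_neq0 ?invr_neq0// pnatr_eq0.
Qed.

Definition outside C p : R :=
  \sum_(s in ~: C.1) p.1 s + \sum_(s in ~: C.2) p.2 s.

Lemma outside_ge0 C p : 0 <= outside C p.
Proof. by rewrite addr_ge0// sumr_ge0// => *; exact: mixed_ge0. Qed.

Lemma sum_mixed_le1 (S : finType) (x : mixed R S) (A : {set S}) :
  \sum_(s in A) x s <= 1.
Proof.
rewrite -(mixed_sum1 x) (big_setIDC A) lerDl sumr_ge0// => *.
exact: mixed_ge0.
Qed.

Lemma outside_le2 C p : outside C p <= 2.
Proof. by rewrite -[2]/(1 + 1) lerD// sum_mixed_le1. Qed.

Lemma outside_update C p s : s.1 \in C.1 -> s.2 \in C.2 ->
  outside C (RWS_update beta p s) = beta%:num * outside C p.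
Proof.
move=> s1 s2; rewrite /outside mulrDr !mulr_sumr.
by congr (_ + _); apply: eq_bigr => t; rewrite inE => tC; rewrite /= !ffunE;
  rewrite eq_sym (negPf (memPn tC _ _)) ?mulr0 ?addr0.
Qed.

Lemma curb_replies1 C (n : {ffun S2 -> 'I_k.+1}) : curb G k C ->
  (\sum_t n t = k)%N -> sample_in C.2 n ->
  best_replies (payoff1 G) (empirical R n) \subset C.1.
Proof.
move=> [[/set0Pn[d1 d1C] _] CP] nk /forallP nC.
have [q qn] := empirical_is_mixed R k_gt0 nk.
(* CURB is tested on full profiles; [pure R d1] fills the coordinate on which the replies of player
   1 do not depend. *)
have [||/= + _] := CP (pure R d1, q).
- split=> /= t tC; first by rewrite ffunE eq_sym (negPf (memPn tC _ _)).
  by rewrite qn /empirical (eqP (implyP (nC t) tC)) mul0r.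
- split=> /= t; first exact: pure_on_grid.
  by exists (Posz (n t)); rewrite qn.
by rewrite (eq_best_replies _ qn).
Qed.

Lemma curb_replies2 C (n : {ffun S1 -> 'I_k.+1}) : curb G k C ->
  (\sum_t n t = k)%N -> sample_in C.1 n ->
  best_replies (payoff2 G) (empirical R n) \subset C.2.
Proof.
move=> [[_ /set0Pn[d2 d2C]] CP] nk /forallP nC.
have [q qn] := empirical_is_mixed R k_gt0 nk.
have [||/= _ +] := CP (q, pure R d2).
- split=> /= t tC; last by rewrite ffunE eq_sym (negPf (memPn tC _ _)).
  by rewrite qn /empirical (eqP (implyP (nC t) tC)) mul0r.
- split=> /= t; last exact: pure_on_grid.
  by exists (Posz (n t)); rewrite qn.
by rewrite (eq_best_replies _ qn).
Qed.

(** Union bound over the players: a reply leaving [C] costs at most 1, and its probability is at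
    most [k] times the opponent's weight off [C]. *)
Lemma RWS_op0_curb f C p (c : R) : curb G k C -> (forall p, f p <= 1) ->
  0 <= c ->
  (forall s, s.1 \in C.1 -> s.2 \in C.2 -> f (RWS_update beta p s) <= c) ->
  RWS_op 0 f p <= c + k%:R * outside C p.
Proof.
move=> CP f1 c0 fc.
pose a := stochastic_best_reply k 0 (payoff1 G) p.2.
pose b := stochastic_best_reply k 0 (payoff2 G) p.1.
have a1 : \sum_s a s = 1 by exact: stochastic_best_reply0_sum1 point.
have b1 : \sum_s b s = 1 by exact: stochastic_best_reply0_sum1 point.
have aC : \sum_s a s * (s \notin C.1)%:R <= k%:R * \sum_(t in ~: C.2) p.2 t.
  have := @stochastic_best_reply0_outside R k _ _ (payoff1 G) C.2 C.1 p.2 point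
    (fun n => curb_replies1 CP).
  apply: le_trans; rewrite [leRHS]big_mkcond; apply: ler_sum => s _.
  by rewrite inE; case: ifP; rewrite ?mulr1 ?mulr0.
have bC : \sum_s b s * (s \notin C.2)%:R <= k%:R * \sum_(t in ~: C.1) p.1 t.
  have := @stochastic_best_reply0_outside R k _ _ (payoff2 G) C.1 C.2 p.1 point
    (fun n => curb_replies2 CP).
  apply: le_trans; rewrite [leRHS]big_mkcond; apply: ler_sum => s _.
  by rewrite inE; case: ifP; rewrite ?mulr1 ?mulr0.
have -> : c + k%:R * outside C p = c + (k%:R * \sum_(t in ~: C.2) p.2 t +
    k%:R * \sum_(t in ~: C.1) p.1 t) by rewrite /outside; ring.
apply: (@le_trans _ _ (c + (\sum_s a s * (s \notin C.1)%:R +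
  \sum_s b s * (s \notin C.2)%:R))); last by rewrite lerD2l lerD.
have -> : \sum_s a s * (s \notin C.1)%:R =
    \sum_(s : S1 * S2) a s.1 * (s.1 \notin C.1)%:R * b s.2.
  by rewrite (sum_prodM (fun t => a t * (t \notin C.1)%:R)) b1 mulr1.
have -> : \sum_s b s * (s \notin C.2)%:R =
    \sum_(s : S1 * S2) a s.1 * (b s.2 * (s.2 \notin C.2)%:R).
  by rewrite (sum_prodM a (fun t => b t * (t \notin C.2)%:R)) a1 mul1r.
have -> : c = \sum_s RWS_prob 0 p s * c by rewrite -mulr_suml RWS_prob_sum1 mul1r.
rewrite -!big_split/=; apply: ler_sum => s _.
(* Move by move, it remains to bound [f] by [c] plus one unit for each player whose reply leaves
   [C]. *)
have -> : RWS_prob 0 p s * c + (a s.1 * (s.1 \notin C.1)%:R * b s.2 +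
    a s.1 * (b s.2 * (s.2 \notin C.2)%:R)) =
  RWS_prob 0 p s * (c + (s.1 \notin C.1)%:R + (s.2 \notin C.2)%:R).
  by rewrite /RWS_prob -/(a s.1) -/(b s.2); ring.
apply: ler_wpM2l; first exact: RWS_prob0_ge0.
have f1s := f1 (RWS_update beta p s).
have [s1|s1] := boolP (s.1 \in C.1); have [s2|s2] := boolP (s.2 \in C.2) => /=;
  rewrite ?addr0; [exact: fc|lra..].
Qed.

End rws.

(** * The Lyapunov function *)

Section lyapunov.
Variables (R : realType) (S1 S2 : pfinType) (G : game R S1 S2).
Variables (k : nat) (beta : {i01 R}).
Implicit Types (p q : profile R S1 S2) (C D : {set S1} * {set S2}).
Hypotheses (k_gt0 : (0 < k)%N) (beta01 : 0 < beta%:num < 1).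

Local Notation b := (beta%:num).
Local Notation RWS0 := (RWS_op G k beta 0).

(** Chosen so that [penalty * b + k = penalty * (1 + b) / 2]: the risk of leaving a block uses up
    half of the decrease. *)
Definition penalty : R := 2 * k%:R / (1 - b).

Definition lyapunov p : R :=
  \big[Num.min/1]_(C | `[< minimal_curb G k C >]) (penalty * outside C p).

Let b_gt0 : 0 < b. Proof. by case/andP: beta01. Qed.
Let b_lt1 : b < 1. Proof. by case/andP: beta01. Qed.

Lemma penalty_gt0 : 0 < penalty.
Proof. by rewrite divr_gt0 ?subr_gt0// mulr_gt0 ?ltr0n. Qed.

Lemma lyapunov_le1 p : lyapunov p <= 1.
Proof. exact: bigmin_le_id. Qed.

Lemma lyapunov_ge0 p : 0 <= lyapunov p.
Proof.
apply/bigmin_geP; split=> // C _.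
by rewrite mulr_ge0 ?outside_ge0// ltW// penalty_gt0.
Qed.

Lemma lyapunov_le C p : minimal_curb G k C ->
  lyapunov p <= penalty * outside C p.
Proof. by move=> Cmin; apply: bigmin_le_cond; apply/asboolP. Qed.

Lemma lyapunov_lt1 p : lyapunov p < 1 ->
  exists2 C, minimal_curb G k C & lyapunov p = penalty * outside C p.
Proof.
rewrite /lyapunov; elim/big_ind: _ => [|x y xP yP|C /asboolP Cmin _].
- by rewrite ltxx.
- by rewrite minEle; case: ifP => _; [exact: xP|exact: yP].
- by exists C.
Qed.

(* From a profile near a minimal CURB block [C] both samples fall inside [C]
   except with probability at most [k * outside C p], and then the outside
   weight shrinks by [b]; the penalty makes the exceptional case affordable. *)
Lemma RWS0_lyapunov_contract p : lyapunov p < 1 ->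
  RWS0 lyapunov p <= (1 + b) / 2 * lyapunov p.
Proof.
move=> /lyapunov_lt1[C Cmin ->].
have -> : (1 + b) / 2 * (penalty * outside C p) =
    penalty * (b * outside C p) + k%:R * outside C p.
  by rewrite /penalty; field; rewrite subr_eq0 gt_eqF.
apply: RWS_op0_curb => //; first exact: Cmin.1.
- exact: lyapunov_le1.
- by rewrite !mulr_ge0 ?outside_ge0// ltW// penalty_gt0.
- by move=> s s1 s2; rewrite -(outside_update beta p s1 s2) lyapunov_le.
Qed.

Lemma RWS0_lyapunov_le p : RWS0 lyapunov p <= lyapunov p.
Proof.
have [l1|] := ltP (lyapunov p) 1.
  rewrite (le_trans (RWS0_lyapunov_contract l1))// ler_piMl ?lyapunov_ge0//.
  by rewrite ler_pdivrMr//; move: b_lt1; lra.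
apply: le_trans; rewrite -[leRHS](RWS_op_cst G k beta 0 1 p).
by apply: RWS_op0_homo => q; exact: lyapunov_le1.
Qed.

(** The mean of [lyapunov] after [n] error-free steps, as a function of the starting profile. *)
Definition iter_lyapunov n : profile R S1 S2 -> R := iter n RWS0 lyapunov.

Lemma iter_lyapunovS n p : iter_lyapunov n.+1 p <= iter_lyapunov n p.
Proof.
elim: n p => [|n IH] p; first exact: RWS0_lyapunov_le.
by rewrite /iter_lyapunov iterS; apply: RWS_op0_homo.
Qed.

(** Allows numbers of steps found for different starting profiles to be raised to a common one. *)
Lemma iter_lyapunov_homo p m n : (m <= n)%N ->
  iter_lyapunov n p <= iter_lyapunov m p.
Proof.
by elim: n => [|n IH]; [rewrite leqn0 => /eqP ->|
  rewrite leq_eqVlt => /orP[/eqP -> //|/IH]; apply: le_trans;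
  exact: iter_lyapunovS].
Qed.

Lemma iter_lyapunov_le1 n p : iter_lyapunov n p <= 1.
Proof. by apply: le_trans (lyapunov_le1 p); exact: (iter_lyapunov_homo p (leq0n n)). Qed.

Lemma iter_lyapunov_ge0 n p : 0 <= iter_lyapunov n p.
Proof.
elim: n p => [|n IH] p; first exact: lyapunov_ge0.
rewrite -[leLHS](RWS_op_cst G k beta 0 0 p) /iter_lyapunov iterS.
exact: RWS_op0_homo.
Qed.

Lemma recency_update_self (S : finType) (x : mixed R S) (s : S) :
  1 - b <= recency_update beta x s s.
Proof. by rewrite /= !ffunE eqxx mulr1 lerDr mulr_ge0 ?mixed_ge0. Qed.

Lemma recency_update_ge (S : finType) (x : mixed R S) (s t : S) (c : R) :
  c <= x t -> b * c <= recency_update beta x s t.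
Proof.
by move=> cx; rewrite /= !ffunE ler_wpDr// ler_wpM2l.
Qed.

(* Sampling the same pair [d] of pure strategies again and again keeps all
   replies inside the block. *)
Lemma iter_lyapunov_minimal_curb D (d : S1 * S2) (L : nat) (c : R) :
  minimal_curb G k D -> d.1 \in D.1 -> d.2 \in D.2 -> 0 < c ->
  exists2 eta, 0 < eta & forall p, c <= p.1 d.1 -> c <= p.2 d.2 ->
    b ^+ L * (penalty * outside D p) <= 2^-1 -> iter_lyapunov L p <= 1 - eta.
Proof.
move=> Dmin d1 d2; elim: L c => [|L IH] c c0.
  exists 2^-1 => [|p _ _]; first by rewrite invr_gt0.
  rewrite expr0 mul1r => pD; apply: le_trans (le_trans (lyapunov_le p Dmin) pD) _.
  lra.
pose q : profile R S1 S2 := (pure R d.1, pure R d.2).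
have qgrid : on_grid k q by split=> s; exact: pure_on_grid.
have qD : square D q.
  by split=> t tD; rewrite ffunE eq_sym (negPf (memPn tD _ _)).
have [BR1 BR2] := Dmin.1.2 q qD qgrid.
have /set0Pn[s1 s1q] := best_replies_neq0 (payoff1 G) q.2 point.
have /set0Pn[s2 s2q] := best_replies_neq0 (payoff2 G) q.1 point.
have s1D := fintype.subsetP BR1 _ s1q; have s2D := fintype.subsetP BR2 _ s2q.
have [e e0 eP] := RWS_prob0_lower k_gt0 (s := (s1, s2)) qgrid s1q s2q c0.
(* One step shrinks the weight of [d] at most by the factor [b], so [d] can still be sampled. *)
have [e' e'0 e'P] := IH (b * c) (mulr_gt0 b_gt0 c0).
exists (e * e') => [|p p1 p2 pD]; first exact: mulr_gt0.
rewrite /iter_lyapunov iterS; apply: (@RWS_op0_escape _ _ _ _ _ _ _ _ (s1, s2)).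
- exact: iter_lyapunov_le1.
- exact: ltW.
- by apply: eP => t; rewrite ffunE pnatr_eq0 eqb0 negbK => /eqP ->.
- apply: e'P; [exact: recency_update_ge..|].
  (* The replies lie in [D], so the outside weight shrinks by [b], which pays for one factor of
     [b ^+ L.+1]. *)
  rewrite outside_update//; apply: le_trans pD.
  by rewrite le_eqVlt exprSr; apply/orP; left; apply/eqP; ring.
Qed.

(** Descent on the total number of strategies: a CURB block that is not minimal contains a
    different, hence strictly smaller, one. *)
Lemma curb_has_minimal C : curb G k C ->
  exists2 D, minimal_curb G k D & sub_block D C.
Proof.
have [m] := ubnP (#|C.1| + #|C.2|)%N.
elim: m C => // m IH C /[!ltnS] Cm CP.
have [Cmin|] := pselect (minimal_curb G k C); first by exists C.
move=> /not_andP[//|/existsNP[D /not_implyP[DP /not_implyP[[D1 D2] DC]]]].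
have [|D' D'min [D'1 D'2]] := IH D _ DP; last first.
  by exists D' => //; split; [apply: fintype.subset_trans D1|
    apply: fintype.subset_trans D2].
rewrite (leq_trans _ Cm)// ltn_neqAle leq_add ?subset_leq_card// andbT.
apply: contra_notN DC => /eqP DCm.
(* Equal totals and the two inclusions force equal cardinalities in each factor, hence [D = C]. *)
have := subset_leq_card D1; have := subset_leq_card D2 => h2 h1.
have E1 : #|D.1| = #|C.1| by apply/eqP; rewrite eqn_leq h1/= -(leq_add2r #|D.2|) DCm leq_add2l.
have E2 : #|D.2| = #|C.2| by move: DCm; rewrite E1 => /addnI.
move: D1 D2; rewrite [D]surjective_pairing [C]surjective_pairing/=.
by move=> D1 D2; congr (_, _); apply/eqP; rewrite eqEcard ?D1 ?D2 ?E1 ?E2 leqnn.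
Qed.

(* A block all of whose strategies are still available for sampling is enlarged
   by best replies to its own samples until it is CURB; the play is then driven
   into a minimal CURB block contained in it. *)
Lemma iter_lyapunov_block C (c : R) : is_block C -> 0 < c ->
  exists n, exists2 eta, 0 < eta & forall p,
    (forall s, s \in C.1 -> c <= p.1 s) ->
    (forall s, s \in C.2 -> c <= p.2 s) -> iter_lyapunov n p <= 1 - eta.
Proof.
have [m] := ubnP (#|~: C.1| + #|~: C.2|)%N.
elim: m C c => // m IH C c /[!ltnS] Cm Cblock c0.
have [CP|] := pselect (curb G k C).
  have [D Dmin [D1 D2]] := curb_has_minimal CP.
  have [[/set0Pn[d1 d1D] /set0Pn[d2 d2D]] _] := Dmin.1.
  (* As [outside] never exceeds 2, this [L] serves every starting profile. *)
  have [L bL] : exists L, b ^+ L * (penalty * 2) <= 2^-1.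
    have /cvgrPdist_le/(_ (2^-1 / (penalty * 2))) : b ^+ n @[n --> \oo] --> (0:R).
      by apply: cvg_expr; rewrite ger0_norm// ltW.
    case=> [|L _ /(_ L (leqnn L))/=].
      by apply: divr_gt0; rewrite ?invr_gt0 ?(mulr_gt0 penalty_gt0).
    rewrite sub0r normrN ger0_norm ?exprn_ge0// => LP; exists L.
    by rewrite -ler_pdivlMr ?(mulr_gt0 penalty_gt0).
  have [e e0 eP] := iter_lyapunov_minimal_curb (d := (d1, d2)) L Dmin d1D d2D c0.
  exists L, e => // p p1 p2; apply: eP => //=.
  - by apply: p1; exact: (fintype.subsetP D1).
  - by apply: p2; exact: (fintype.subsetP D2).
  - apply: le_trans bL; rewrite ler_wpM2l ?exprn_ge0// ler_wpM2l ?outside_le2//.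
    by rewrite ltW// penalty_gt0.
move=> /not_andP[//|/existsNP[q /not_implyP[qC /not_implyP[qgrid qBR]]]].
(* Failure of CURB at [q] provides a pair of best replies at least one of which is new to [C]. *)
have [s1 [s2 [s1q s2q sC]]] : exists s1 s2, [/\ s1 \in (BR G q).1,
    s2 \in (BR G q).2 & (s1 \notin C.1) || (s2 \notin C.2)].
  have /set0Pn[s1 s1q] := best_replies_neq0 (payoff1 G) q.2 point.
  have /set0Pn[s2 s2q] := best_replies_neq0 (payoff2 G) q.1 point.
  move/not_andP: qBR => [/negP|/negP] /fintype.subsetPn[s sq sC].
    by exists s, s2; rewrite sC.
  by exists s1, s; rewrite sC orbT.
have [e e0 eP] := RWS_prob0_lower k_gt0 (s := (s1, s2)) qgrid s1q s2q c0.
pose C' := (s1 |: C.1, s2 |: C.2)%SET.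
(* After the step, old strategies keep weight at least [b * c] and those just played have at least
   [1 - b]. *)
pose c' := Num.min (b * c) (1 - b).
have c'0 : 0 < c' by rewrite lt_min mulr_gt0//= subr_gt0.
have C'm : (#|~: C'.1| + #|~: C'.2| < m)%N.
  apply: leq_trans Cm; rewrite /C' /= !finset.setCU.
  have [s1C|s1C] := boolP (s1 \in C.1); last first.
    rewrite -addSn leq_add//.
      by rewrite finset.setIC -finset.setDE [leqRHS](cardsD1 s1) inE s1C.
    by rewrite subset_leq_card// finset.subsetIr.
  rewrite s1C/= in sC; rewrite -addnS leq_add//.
    by rewrite subset_leq_card// finset.subsetIr.
  by rewrite finset.setIC -finset.setDE [leqRHS](cardsD1 s2) inE sC.
have [|n [e' e'0 e'P]] := IH C' c' C'm _ c'0.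
  by split; apply/set0Pn; [exists s1|exists s2]; rewrite !inE eqxx.
exists n.+1, (e * e') => [|p p1 p2]; first exact: mulr_gt0.
rewrite /iter_lyapunov iterS; apply: (@RWS_op0_escape _ _ _ _ _ _ _ _ (s1, s2)).
- exact: iter_lyapunov_le1.
- exact: ltW.
- by apply: eP => t qt; [apply: p1|apply: p2]; apply: contraNT qt => tC;
    rewrite ?qC.1 ?qC.2.
- apply: e'P => t; rewrite in_setU1 => /predU1P[->|tC]; rewrite ge_min.
  + by rewrite recency_update_self orbT.
  + by rewrite recency_update_ge// p1.
  + by rewrite recency_update_self orbT.
  + by rewrite recency_update_ge// p2.
Qed.

(** Not all weights can lie below their average. *)
Lemma mixed_ge_invcard (S : pfinType) (x : mixed R S) :
  exists s, #|S|%:R^-1 <= x s.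
Proof.
apply: contrapT => /forallNP xs.
suff : \sum_s x s < \sum_(s : S) #|S|%:R^-1.
  have S0 : #|S|%:R != 0 :> R by rewrite pnatr_eq0 -lt0n; apply/card_gt0P; exists point.
  by rewrite mixed_sum1 sumr_const -[_ *+ _]mulr_natr mulVf// ltxx.
apply: ltr_sum => [|s _]; first by apply/hasP; exists point; rewrite ?mem_index_enum.
by rewrite ltNge; apply/negP; exact: xs.
Qed.

(** Start from the singleton block of a pair with weights at least [c]; there are only finitely many
    such pairs. *)
Lemma iter_lyapunov_uniform :
  exists n, exists2 eta, 0 < eta & forall p, iter_lyapunov n p <= 1 - eta.
Proof.
pose c : R := Num.min #|S1|%:R^-1 #|S2|%:R^-1.
have c0 : 0 < c.
  by rewrite lt_min !invr_gt0 !ltr0n; apply/andP; split; apply/card_gt0P;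
    exists point.
(* One natural number encodes both the number of steps and the gain [N.+1%:R^-1], so a single
   maximum over [d] makes both uniform. *)
have /choice[N NP] (d : S1 * S2) : exists N, forall p,
    c <= p.1 d.1 -> c <= p.2 d.2 -> iter_lyapunov N p <= 1 - N.+1%:R^-1.
  have [|n [e e0 eP]] := @iter_lyapunov_block ([set d.1], [set d.2])%SET c _ c0.
    by split; apply/set0Pn; [exists d.1|exists d.2]; rewrite inE.
  pose N := maxn n (Num.truncn e^-1); exists N => p p1 p2.
  apply: (le_trans (iter_lyapunov_homo p (leq_maxl _ _ : (n <= N)%N))).
  apply: le_trans (eP p _ _) _; rewrite ?lerD2l ?lerN2 /=.
  - by move=> s /set1P ->.
  - by move=> s /set1P ->.
  - rewrite invf_ple ?posrE ?ltr0n// (le_trans (ltW (truncnS_gt _)))//.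
    by rewrite ler_nat ltnS leq_maxr.
pose M := (\max_d N d)%N.
exists M, M.+1%:R^-1 => [|p]; first by rewrite invr_gt0 ltr0n.
have [s1 p1] := mixed_ge_invcard p.1; have [s2 p2] := mixed_ge_invcard p.2.
have NM : (N (s1, s2) <= M)%N by exact: leq_bigmax.
apply: (le_trans (iter_lyapunov_homo p NM)).
apply: le_trans (NP (s1, s2) p _ _) _; rewrite ?ge_min ?p1 ?p2 ?orbT//.
by rewrite lerD2l lerN2 lef_pV2 ?posrE ?ltr0n// ler_nat ltnS.
Qed.

Lemma iter_lyapunov_contract :
  exists n, exists2 gamma, 0 <= gamma < 1 &
    forall p, iter_lyapunov n p <= gamma * lyapunov p.
Proof.
have [n [e e0 eP]] := iter_lyapunov_uniform.
(* The first rate is for [lyapunov p < 1], where one step already contracts, hence [n.+1] rather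
   than [n]; the second is for [lyapunov p = 1]. *)
exists n.+1, (Num.max ((1 + b) / 2) (1 - e)).
  rewrite gt_max ltr_pdivrMr// gtrBl e0 andbT le_max divr_ge0//=.
  by move: b_lt1; lra.
move=> p; have [l1|l1] := ltP (lyapunov p) 1.
  apply: (le_trans (iter_lyapunov_homo p (ltn0Sn n))).
  apply: (le_trans (RWS0_lyapunov_contract l1)).
  by rewrite ler_wpM2r ?lyapunov_ge0// le_max lexx.
have -> : lyapunov p = 1 by apply/eqP; rewrite eq_le l1 lyapunov_le1.
rewrite mulr1 (le_trans (iter_lyapunovS n p))// (le_trans (eP p))//.
by rewrite le_max lexx orbT.
Qed.

End lyapunov.

(** * Invariant measures *)

Section measurability.
Variable R : realType.

Lemma measurable_mixed_coord (S : pfinType) (s : S) :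
  measurable_fun [set: mixed R S] (fun x : mixed R S => x s).
Proof.
by move=> _ B mB; rewrite setTI; apply: sub_sigma_algebra; exists s, B.
Qed.

(** It suffices to test the generating cylinders, that is, each coordinate, which is affine in the
    old one. *)
Lemma measurable_recency_update (S : pfinType) (beta : {i01 R}) (s : S) :
  measurable_fun [set: mixed R S] (fun x => recency_update beta x s).
Proof.
apply: (measurability (mixed_cylinders (R := R) (S := S))) => //.
move=> _ [_ [t [B [mB ->]]] <-]; rewrite setTI -comp_preimage -[X in measurable X]setTI.
suff : measurable_fun [set: mixed R S] (fun x => recency_update beta x s t).
  by apply.
under eq_fun do rewrite /= ffunE.
by apply: measurable_funD => //; apply: measurable_funM => //;
  exact: measurable_mixed_coord.
Qed.

Lemma measurable_stochastic_best_reply (k : nat) (eps : R) (S : finType)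
    (T : pfinType) (u : S -> T -> R) (s : S) :
  measurable_fun [set: mixed R T]
    (fun x => stochastic_best_reply k eps u x s).
Proof.
rewrite /stochastic_best_reply; apply: measurable_sum => n; apply: measurable_funM => //.
rewrite /multinomial_pmf; case: (_ == _) => //; apply: measurable_funM => //.
apply: measurable_prod => t _; apply: measurable_funX.
exact: measurable_mixed_coord.
Qed.

Variables (S1 S2 : pfinType) (G : game R S1 S2) (k : nat) (beta : {i01 R}).

Lemma measurable_RWS_update s : measurable_fun [set: profile R S1 S2]
  (fun p => RWS_update beta p s).
Proof.
apply: measurable_fun_pair.
- exact: measurableT_comp (measurable_recency_update beta s.1) measurable_fst.
- exact: measurableT_comp (measurable_recency_update beta s.2) measurable_snd.
Qed.

Lemma measurable_RWS_op (eps : R) f : measurable_fun [set: profile R S1 S2] f ->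
  measurable_fun [set: profile R S1 S2] (RWS_op G k beta eps f).
Proof.
move=> mf; apply: measurable_sum => s; apply: measurable_funM.
  apply: measurable_funM.
    exact: measurableT_comp
      (measurable_stochastic_best_reply k eps (payoff1 G) s.1) measurable_snd.
  exact: measurableT_comp
    (measurable_stochastic_best_reply k eps (payoff2 G) s.2) measurable_fst.
exact: measurableT_comp mf (measurable_RWS_update s).
Qed.

Lemma measurable_face_weight1 (A : {set S1}) :
  measurable_fun [set: profile R S1 S2] (fun p => \sum_(s in A) p.1 s).
Proof.
under eq_fun do rewrite big_mkcond; apply: measurable_sum => s.
case: (_ \in _) => //.
exact: measurableT_comp (measurable_mixed_coord s) measurable_fst.
Qed.

Lemma measurable_face_weight2 (A : {set S2}) :
  measurable_fun [set: profile R S1 S2] (fun p => \sum_(s in A) p.2 s).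
Proof.
under eq_fun do rewrite big_mkcond; apply: measurable_sum => s.
case: (_ \in _) => //.
exact: measurableT_comp (measurable_mixed_coord s) measurable_snd.
Qed.

Lemma measurable_lyapunov :
  measurable_fun [set: profile R S1 S2] (lyapunov G k beta).
Proof.
rewrite /lyapunov; elim: index_enum => [|C r IH].
  by under eq_fun do rewrite big_nil; exact: measurable_cst.
under eq_fun do rewrite big_cons.
case: asboolP => _ //; apply: measurable_minr => //.
apply: measurable_funM => //; apply: measurable_funD.
- exact: measurable_face_weight1.
- exact: measurable_face_weight2.
Qed.

Lemma measurable_block_nbhd (delta : R) (C : {set S1} * {set S2}) :
  measurable (block_nbhd delta C).
Proof.
rewrite (_ : block_nbhd delta C =
    ((fun p : profile R S1 S2 => \sum_(s in C.1) p.1 s) @^-1` `[1 - delta, +oo[) `&`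
    ((fun p : profile R S1 S2 => \sum_(s in C.2) p.2 s) @^-1` `[1 - delta, +oo[)); last first.
  by apply/seteqP; split=> p /=; rewrite !in_itv/= !andbT.
apply: measurableI; rewrite -[X in measurable X]setTI.
- exact: measurable_face_weight1.
- exact: measurable_face_weight2.
Qed.

End measurability.

(** The sum counts the naturals below [x]: it is the ceiling of [x]. *)
Lemma sum_lt_nat_bounds (R : realDomainType) (x : R) (N : nat) :
  0 <= x <= N%:R -> x <= \sum_(j < N) (j%:R < x)%R%:R <= x + 1.
Proof.
move=> /andP[x0 xN]; elim: N xN => [|N IH] xN.
  by rewrite big_ord0 xN addr_ge0.
rewrite big_ord_recr/=; have [Nx|xN'] := ltP N%:R x; last by rewrite addr0 IH.
have -> : \sum_(i < N) (i%:R < x)%R%:R = N%:R :> R.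
  rewrite (eq_bigr (fun=> 1)) ?sumr_const ?card_ord// => i _.
  by rewrite (le_lt_trans _ Nx)// ler_nat ltnW.
by rewrite natr1 xN -natr1 lerD2r ltW.
Qed.

Lemma ge0_integral_scaled_sum d (T : measurableType d) (R : realType)
    (mu : {measure set T -> \bar R}) (c : R) (n : nat) (h : 'I_n -> T -> R) :
  0 <= c -> (forall j, measurable_fun [set: T] (h j)) ->
  (forall j x, 0 <= h j x) ->
  (\int[mu]_x (c * \sum_(j < n) h j x)%:E =
  c%:E * \sum_(j < n) \int[mu]_x (h j x)%:E)%E.
Proof.
move=> c0 mh h0.
under eq_integral do rewrite EFinM -sumEFin.
rewrite ge0_integralZl_EFin//.
- rewrite ge0_integral_sum// => j.
  + exact/measurable_EFinP.
  + by move=> x _; rewrite lee_fin.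
- by move=> x _; rewrite sumEFin lee_fin sumr_ge0.
- by under eq_fun do rewrite sumEFin; apply/measurable_EFinP; exact: measurable_sum.
Qed.

(** * Integrals against an invariant measure *)

Section invariant.
Variables (R : realType) (S1 S2 : pfinType) (G : game R S1 S2).
Variables (k : nat) (beta : {i01 R}) (eps : R).
Variable mu : probability (profile R S1 S2) R.
Hypotheses (eps01 : 0 <= eps <= 1) (mu_inv : RWS_invariant G k beta eps mu).
Implicit Types f : profile R S1 S2 -> R.

Local Notation RWS := (RWS_op G k beta eps).

Lemma RWS_kernelE A p : RWS_kernel G k beta eps p A = (RWS \1_A p)%:E.
Proof. by rewrite /RWS_kernel /RWS_op -sumEFin; apply: eq_bigr. Qed.

(* Layer-cake approximation of [f] by the indicators of its superlevel sets,
   for which the inequality is the invariance of [mu]. *)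
Lemma invariant_integral_le f : measurable_fun [set: profile R S1 S2] f ->
  (forall p, 0 <= f p <= 1) ->
  (\int[mu]_p (f p)%:E <= \int[mu]_p (RWS f p)%:E)%E.
Proof.
move=> mf f01; apply/lee_addgt0Pr => e e0.
pose N := (Num.truncn e^-1).+1.
have N0 : 0 < N%:R :> R by rewrite ltr0n.
have Ne : N%:R^-1 <= e.
  by rewrite invf_ple ?posrE// ltW// truncnS_gt.
pose A (j : 'I_N) := [set p | j%:R < N%:R * f p].
have mA j : measurable (A j).
  rewrite (_ : A j = (fun p => N%:R * f p) @^-1` `]j%:R, +oo[); last first.
    by apply/seteqP; split=> p /=; rewrite in_itv/= andbT.
  by rewrite -[X in measurable X]setTI; apply: measurable_funM.
(* This is [f] rounded up to a multiple of [N%:R^-1], so it exceeds [f] by at most [e]. *)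
pose g p := N%:R^-1 * \sum_(j < N) \1_(A j) p : R.
have fg p : f p <= g p <= f p + N%:R^-1.
  have /andP[f0 f1] := f01 p.
  have : 0 <= N%:R * f p <= N%:R by rewrite mulr_ge0 ?ler_piMr ?ler0n.
  move=> /sum_lt_nat_bounds.
  have -> : \sum_(j < N) (j%:R < N%:R * f p)%R%:R = \sum_(j < N) \1_(A j) p :> R.
    by apply: eq_bigr => j _; rewrite indicE mem_setE.
  rewrite /g ler_pdivlMl// => /andP[-> /=]; rewrite ler_pdivrMl//.
  by rewrite mulrDr divff// gt_eqF.
have RWS_g p : RWS g p = N%:R^-1 * \sum_(j < N) RWS \1_(A j) p.
  rewrite /RWS_op exchange_big/= mulr_sumr; apply: eq_bigr => s _.
  by rewrite /g mulrCA -mulr_sumr.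
have mI j : measurable_fun [set: profile R S1 S2] (\1_(A j) : _ -> R).
  exact: measurable_indic.
have I0 j p : 0 <= \1_(A j) p :> R by rewrite indicE.
have mRWS f' : measurable_fun [set: profile R S1 S2] f' ->
    measurable_fun [set: profile R S1 S2] (EFin \o RWS f').
  by move=> mf'; apply/measurable_EFinP; exact: measurable_RWS_op.
have RWS_ge0 f' p : (forall q, 0 <= f' q) -> 0 <= RWS f' p.
  by move=> f'0; rewrite sumr_ge0// => s _; rewrite mulr_ge0 ?RWS_prob_ge0.
have mg : measurable_fun [set: profile R S1 S2] g.
  by apply: measurable_funM => //; exact: measurable_sum.
apply: (@le_trans _ _ (\int[mu]_p (g p)%:E)%E).
  apply: ge0_le_integral => //.
  - by move=> p _; rewrite lee_fin; case/andP: (f01 p).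
  - exact/measurable_EFinP.
  - exact/measurable_EFinP.
  - by move=> p _; rewrite lee_fin; case/andP: (fg p).
have -> : (\int[mu]_p (g p)%:E = \int[mu]_p (RWS g p)%:E)%E.
  rewrite ge0_integral_scaled_sum ?invr_ge0 ?ltW//.
  under [RHS]eq_integral do rewrite RWS_g.
  rewrite (@ge0_integral_scaled_sum _ _ _ mu _ _ (fun j => RWS \1_(A j)))//.
  - congr (_ * _)%E; apply: eq_bigr => j _.
    rewrite integral_indic// setIT.
    apply: etrans (esym (mu_inv (mA j))) _.
    by apply: eq_integral => p _; rewrite RWS_kernelE.
  - by move=> j; exact: measurable_RWS_op.
  - by move=> j p; exact: RWS_ge0.
have -> : e%:E = (\int[mu]_p (e%:E))%E.
  by rewrite integral_cst//= probability_setT mule1.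
have f0 q : 0 <= f q by case/andP: (f01 q).
rewrite -ge0_integralD//; last 3 first.
- by move=> p _; rewrite lee_fin RWS_ge0.
- exact: mRWS.
- by move=> p _; rewrite lee_fin ltW.
apply: ge0_le_integral => //.
- by move=> p _; rewrite lee_fin RWS_ge0// => q; case/andP: (fg q) => + _; exact: le_trans.
- exact: mRWS.
- by apply: emeasurable_funD; [exact: mRWS|exact: measurable_cst].
move=> p _; rewrite -EFinD lee_fin.
have -> : RWS f p + e = RWS (fun q => f q + e) p.
  rewrite -[X in _ + X](RWS_op_cst G k beta eps e p) /RWS_op -big_split/=.
  by apply: eq_bigr => s _; rewrite mulrDr.
apply: RWS_op_homo => // q; case/andP: (fg q) => _ /le_trans; apply.
by rewrite lerD2l.
Qed.

End invariant.

(** * Concentration near the minimal CURB blocks *)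

Section concentration.
Variables (R : realType) (S1 S2 : pfinType) (G : game R S1 S2).
Variables (k : nat) (beta : {i01 R}).
Hypotheses (k_gt0 : (0 < k)%N) (beta01 : 0 < beta%:num < 1).
Implicit Types (eps delta : R) (mu : probability (profile R S1 S2) R).

Lemma measurable_iter_lyapunov n :
  measurable_fun [set: profile R S1 S2] (iter_lyapunov G k beta n).
Proof.
elim: n => [|n IH]; first exact: measurable_lyapunov.
exact: measurable_RWS_op IH.
Qed.

(** Invariance inserts one step of the chain with errors; replacing it by an error-free step costs
    the last term. *)
Lemma integral_iter_lyapunov_step eps mu n :
  0 <= eps <= 1 -> RWS_invariant G k beta eps mu ->
  (\int[mu]_p (iter_lyapunov G k beta n p)%:E <=
   \int[mu]_p (iter_lyapunov G k beta n.+1 p)%:E +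
   (3 * eps * (#|S1| * #|S2|)%:R)%:E)%E.
Proof.
move=> e01 mu_inv; have /andP[e0 _] := e01.
set c := 3 * eps * _; have c0 : 0 <= c by rewrite !mulr_ge0.
have mI j : measurable_fun [set: profile R S1 S2]
    (EFin \o iter_lyapunov G k beta j).
  by apply/measurable_EFinP; exact: measurable_iter_lyapunov.
have I01 j p : 0 <= iter_lyapunov G k beta j p <= 1.
  by rewrite iter_lyapunov_ge0// iter_lyapunov_le1.
have -> : c%:E = (\int[mu]_p (c%:E))%E.
  by rewrite integral_cst//= probability_setT mule1.
have /le_trans := invariant_integral_le e01 mu_inv
  (measurable_iter_lyapunov n) (I01 n).
apply; rewrite -ge0_integralD//; last 2 first.
- by move=> p _; rewrite lee_fin; case/andP: (I01 n.+1 p).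
- exact: mI.
apply: ge0_le_integral => //.
- move=> p _; rewrite lee_fin sumr_ge0// => s _.
  by rewrite mulr_ge0 ?RWS_prob_ge0//; case/andP: (I01 n (RWS_update beta p s)).
- by apply/measurable_EFinP; apply: measurable_RWS_op; exact: measurable_iter_lyapunov.
- by apply: emeasurable_funD; [exact: mI|exact: measurable_cst].
- move=> p _; rewrite -EFinD lee_fin.
  exact: RWS_op_le e01 (I01 n).
Qed.

(** Chaining [n] such steps and contracting gives [I <= gamma * I + n * c * eps] for the integral
    [I], to be solved for [I]. *)
Lemma integral_lyapunov_le : exists2 K : R, 0 <= K & forall eps mu,
  0 <= eps <= 1 -> RWS_invariant G k beta eps mu ->
  (\int[mu]_p (lyapunov G k beta p)%:E <= (K * eps)%:E)%E.
Proof.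
have [n [gamma /andP[g0 g1] gP]] := iter_lyapunov_contract G k_gt0 beta01.
pose c : R := 3 * (#|S1| * #|S2|)%:R.
have c0 : 0 <= c by rewrite mulr_ge0.
exists (n%:R * c / (1 - gamma)).
  by rewrite divr_ge0 ?subr_ge0 ?mulr_ge0// ltW.
move=> eps mu e01 mu_inv; have /andP[e0 _] := e01.
set I := (\int[mu]_p (lyapunov G k beta p)%:E)%E.
have mV : measurable_fun [set: profile R S1 S2] (EFin \o lyapunov G k beta).
  by apply/measurable_EFinP; exact: measurable_lyapunov.
have I0 : (0 <= I)%E.
  by apply: integral_ge0 => p _; rewrite lee_fin lyapunov_ge0.
have I1 : (I <= 1)%E.
  have -> : 1%E = (\int[mu]_p (1%:E))%E.
    by rewrite integral_cst//= probability_setT mule1.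
  apply: ge0_le_integral => //.
  - by move=> p _; rewrite lee_fin lyapunov_ge0.
  - by move=> p _; rewrite lee_fin lyapunov_le1.
have In j : (I <= \int[mu]_p (iter_lyapunov G k beta j p)%:E +
    (j%:R * (c * eps))%:E)%E.
  elim: j => [|j IH]; first by rewrite mul0r adde0.
  apply: (le_trans IH); rewrite -natr1 mulrDl mul1r [(_ + c * eps)%R]addrC EFinD addeA leeD2r//.
  have := integral_iter_lyapunov_step j e01 mu_inv.
  by rewrite /c mulrAC.
have Ig : (\int[mu]_p (iter_lyapunov G k beta n p)%:E <= gamma%:E * I)%E.
  rewrite /I -ge0_integralZl_EFin//; last first.
    by move=> p _; rewrite lee_fin lyapunov_ge0.
  apply: ge0_le_integral => //.
  - by move=> p _; rewrite lee_fin iter_lyapunov_ge0.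
  - by apply/measurable_EFinP; exact: measurable_iter_lyapunov.
  - by apply/measurable_EFinP; apply: measurable_funM => //; exact: measurable_lyapunov.
  - by move=> p _; rewrite -EFinM lee_fin.
have : (I <= gamma%:E * I + (n%:R * (c * eps))%:E)%E.
  by apply: (le_trans (In n)); rewrite leeD2r.
(* Finiteness is what permits subtracting [gamma * I] from both sides. *)
have Ifin : I \is a fin_num.
  by rewrite ge0_fin_numE// (le_lt_trans I1)// ltry.
rewrite -(fineK Ifin) -EFinM -EFinD !lee_fin => II.
rewrite mulrAC ler_pdivlMr ?subr_gt0//; move: II; lra.
Qed.

(** If the value were smaller, it would be attained at a minimal CURB block [C] with
    [outside C p < delta], placing [p] in the neighbourhood of [C]. *)
Lemma lyapunov_ge_off_nbhd delta p :
  ~ (\bigcup_(C in [set C | minimal_curb G k C]) block_nbhd delta C) p ->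
  Num.min 1 (penalty k beta * delta) <= lyapunov G k beta p.
Proof.
move=> pC; rewrite leNgt; apply/negP; rewrite lt_min => /andP[l1 ld].
have [C Cmin VC] := lyapunov_lt1 l1; apply: pC; exists C => //.
move: ld; rewrite VC ltr_pM2l ?penalty_gt0// /outside => ld.
have D1 := big_setIDC C.1 p.1; have D2 := big_setIDC C.2 p.2.
rewrite !mixed_sum1 in D1 D2.
have g1 : 0 <= \sum_(s in ~: C.1) p.1 s by rewrite sumr_ge0// => *; exact: mixed_ge0.
have g2 : 0 <= \sum_(s in ~: C.2) p.2 s by rewrite sumr_ge0// => *; exact: mixed_ge0.
by split; lra.
Qed.

(** Markov's inequality for [lyapunov], with its lower bound [kappa] off the neighbourhoods as
    threshold. *)
Lemma RWS_invariant_concentration delta : 0 < delta ->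
  exists K : R, forall eps mu,
  0 <= eps <= 1 -> RWS_invariant G k beta eps mu ->
  ((1 - K * eps)%:E <=
    mu (\bigcup_(C in [set C | minimal_curb G k C]) block_nbhd delta C))%E.
Proof.
move=> d0; have [K K0 KP] := integral_lyapunov_le.
set B := \bigcup_(_ in _) _.
have mB : measurable B.
  by apply: fin_bigcup_measurable => // C _; exact: measurable_block_nbhd.
set kappa := Num.min 1 (penalty k beta * delta).
have kappa0 : 0 < kappa by rewrite lt_min ltr01 mulr_gt0 ?penalty_gt0.
exists (K / kappa) => eps mu e01 mu_inv.
have mBC : measurable (~` B) by exact: measurableC.
have kB : (kappa%:E * mu (~` B) <= (K * eps)%:E)%E.
  apply: le_trans (KP _ _ e01 mu_inv).
  rewrite -[~` B]setIT -integral_indic// -ge0_integralZl_EFin//; last 2 first.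
  - by apply/measurable_EFinP; exact: measurable_indic.
  - exact: ltW.
  apply: ge0_le_integral => //.
  - by move=> p _; rewrite -EFinM lee_fin indicE mulr_ge0// ltW.
  - by apply/measurable_EFinP; apply: measurable_funM => //; exact: measurable_indic.
  - by apply/measurable_EFinP; exact: measurable_lyapunov.
  - move=> p _; rewrite -EFinM lee_fin indicE.
    have [pB|_] := boolP (p \in ~` B); last by rewrite mulr0 lyapunov_ge0.
    by rewrite mulr1 lyapunov_ge_off_nbhd//; rewrite inE in pB.
move: kB; rewrite probability_setC//.
have muB : mu B \is a fin_num by exact: fin_num_measure.
rewrite -(fineK muB) -EFinB -EFinM !lee_fin => kB.
rewrite lerBlDl -lerBlDr mulrAC ler_pdivlMr//.
by rewrite mulrC.
Qed.

End concentration.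

Theorem theorem5 (R : realType) (S1 S2 : pfinType) (G : game R S1 S2)
    (k : nat) (beta : {i01 R})
    (mu : R -> probability (profile R S1 S2) R) :
  (0 < k)%N ->
  1 - (maxn #|S1| #|S2|)%:R^-1 < beta%:num < 1 ->
  (forall eps : R, 0 < eps <= 1 -> RWS_invariant G k beta eps (mu eps)) ->
  forall delta : R, 0 < delta ->
    mu eps (\bigcup_(C in [set C | minimal_curb G k C]) block_nbhd delta C)
      @[eps --> 0^'+] --> 1%E.
Proof.
move=> k0 /andP[bm b1] mu_inv delta d0.
have b01 : 0 < beta%:num < 1.
  (* The strategy sets are nonempty, so the lower bound on [beta] is nonnegative. *)
  rewrite b1 andbT (le_lt_trans _ bm)// subr_ge0 invf_le1 ?ler1n ?ltr0n//.
    by rewrite leq_max; apply/orP; left; apply/card_gt0P; exists point.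
  by rewrite leq_max; apply/orP; left; apply/card_gt0P; exists point.
have [K KP] := RWS_invariant_concentration G k0 b01 d0.
(* Since [K] depends neither on [eps] nor on the measure, the mass is squeezed between [1 - K * eps]
   and 1. *)
apply: (@squeeze_cvge _ _ _ _ (fun eps => (1 - K * eps)%:E) _ (fun=> 1%E)).
- near=> eps; have e01 : 0 < eps <= 1.
    by apply/andP; split; near: eps; [exact: nbhs_right_gt|exact: nbhs_right_le].
  rewrite probability_le1 ?andbT; last first.
    by apply: fin_bigcup_measurable => // C _; exact: measurable_block_nbhd.
  by apply: KP; [case/andP: e01 => /ltW -> ->|exact: mu_inv].
- apply: cvg_EFin; first by near=> eps.
  rewrite [X in _ --> X](_ : _ = 1 - K * 0); last by rewrite mulr0 subr0.
  apply: cvgB; first exact: cvg_cst.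
  by apply: cvgM; [exact: cvg_cst|exact: cvg_at_right_filter].
- exact: cvg_cst.
Unshelve. all: end_near. Qed.
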